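(* Let $X$ be a Polish space. For every $k\ge2$ there is a constant $B_k$ (depending only on $k$) such that for every $N\ge k$, every $\mu_k\in\mathcal P_{N-\mathrm{rep}}(X^k)$, every $\alpha\in\mathcal P(\mathcal P(X))$ with $\alpha(\mathcal P_{\frac1N}(X))=1$ and $\mu_k=\int_{\mathcal P_{1/N}(X)}F_{N,k}(\lambda)\,d\alpha(\lambda)$, and every $p\in\{1,\dots,k-2\}$, $$\Big\|\mu_k-\int_{\mathcal P(X)}\frac{N^{k-1}}{\prod_{j=1}^{k-1}(N-j)}\Big[\lambda^{\otimes k}+\sum_{j=1}^p\frac{(-1)^j}{N^j}S_kP_j^{(k)}(\lambda)\Big]d\alpha(\lambda)\Big\|_{\mathrm{TV}}\le\frac{B_k}{N^{p+1}}.$$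
   Context: $\mathcal P(Y)$ denotes the Borel probability measures on a Polish space $Y$, with the narrow topology (convergence tested against bounded continuous functions). For $\gamma\in\mathcal P(X^N)$ and a permutation $\sigma$ of $\{1,\dots,N\}$, $\gamma^\sigma$ is defined by $\int\varphi\,d\gamma^\sigma=\int\varphi(x_{\sigma(1)},\dots,x_{\sigma(N)})\,d\gamma$; $S_N\gamma=\frac1{N!}\sum_\sigma\gamma^\sigma$ (analogously $S_k$ on $X^k$, extended linearly to finite signed measures). $M_k\gamma$ is the $k$-point marginal $(M_k\gamma)(A)=\gamma(A\times X^{N-k})$. $\mathcal P_{N-\mathrm{rep}}(X^k)=\{M_k\gamma:\gamma\in\mathcal P(X^N),\ S_N\gamma=\gamma\}$. $\mathcal P_{\frac1N}(X)=\{\frac1N\sum_{i=1}^N\delta_{x_i}: x_1,\dots,x_N\in X\text{ not necessarily distinct}\}$. For every $\mu_k\in\mathcal P_{N-\mathrm{rep}}(X^k)$ a measure $\alpha$ as in the claim exists. For signed measures, $\|\mu-\nu\|_{\mathrm{TV}}=\sup_A|\mu(A)-\nu(A)|$ over Borel sets $A$. Integrals of measure-valued functions are understood by testing against bounded continuous functions. For $\lambda\in\mathcal P(X)$, $\lambda^{\otimes m}$ is the $m$-fold product (factor omitted if $m=0$) and $\mathrm{id}^{\otimes m}_\#\lambda$ the push-forward of $\lambda$ under $x\mapsto(x,\dots,x)\in X^m$. A partition of $j\in\mathbb N$ of length $n$ is $\mathbf p=(p_1\ge\dots\ge p_n)\in\mathbb N^n$ ($\mathbb N=\{1,2,\dots\}$)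 with $\sum p_i=j$; $n(\mathbf p)=n$; $\mathrm{Ran}\,\mathbf p$ is the set of values of its components and $|\mathbf p^{-1}(q)|$ the number of components equal to $q$. Define $$F_{N,k}(\lambda)=\frac{N^{k-1}}{\prod_{i=1}^{k-1}(N-i)}\Big[\lambda^{\otimes k}+\sum_{j=1}^{k-1}\frac{(-1)^j}{N^j}S_kP_j^{(k)}(\lambda)\Big],$$ $$P_j^{(k)}(\lambda)=\sum_{\substack{\mathbf p\text{ partition of }j\\ j+n(\mathbf p)\le k}}d_{\mathbf p}^{(k)}\,\mathrm{id}^{\otimes(p_1+1)}_\#\lambda\otimes\cdots\otimes\mathrm{id}^{\otimes(p_{n(\mathbf p)}+1)}_\#\lambda\otimes\lambda^{\otimes(k-j-n(\mathbf p))},$$ $$d_{\mathbf p}^{(k)}=\frac{k!}{(k-j-n(\mathbf p))!}\prod_{i=1}^{n(\mathbf p)}\frac1{p_i+1}\prod_{q\in\mathrm{Ran}\,\mathbf p}\frac1{(|\mathbf p^{-1}(q)|)!}.$$ *)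

(* Defs.v *)
From HB Require Import structures.
From mathcomp Require Import all_boot all_order all_algebra all_fingroup.
From mathcomp Require Import all_classical all_reals all_analysis.

Set Implicit Arguments.
Unset Strict Implicit.
Unset Printing Implicit Defensive.

Import Order.TTheory GRing.Theory Num.Theory.
Import numFieldNormedType.Exports.

Local Open Scope classical_set_scope.
Local Open Scope ring_scope.

(* A measure type of the library carries a point, so spaces are nonempty
   throughout; the empty space carries no probability measure. *)

Definition complete_metric (R : realType) (X : topologicalType)
    (d : X -> X -> R) : Prop :=
  [/\ (forall x y, 0 <= d x y /\ (d x y = 0 <-> x = y)),
      (forall x y, d x y = d y x),
      (forall x y z, d x z <= d x y + d y z),
      (forall (x : X) (A : set X),
        nbhs x A <-> exists2 e : R, 0 < e & [set y | d x y < e] `<=` A) &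
      (forall u : nat -> X,
        (forall e : R, 0 < e -> exists n0 : nat, forall m n : nat,
           (n0 <= m)%N -> (n0 <= n)%N -> d (u m) (u n) < e) ->
        exists l : X, u @ \oo --> l)].

Definition polish_space (R : realType) (X : topologicalType) : Prop :=
  (exists2 D : set X, countable D & dense D) /\
  (exists d : X -> X -> R, complete_metric d).

HB.mixin Record isPolish (R : realType) X & PointedTopological X := {
  polishP : polish_space R X
}.

#[short(type="polishType")]
HB.structure Definition Polish (R : realType) :=
  { X of PointedTopological X & isPolish R X }.

Notation borel T := (g_sigma_algebraType (@open T)).

Notation Xpow X k := (prod_topology (fun _ : 'I_k => X)).

HB.instance Definition _ (I : Type) (X : I -> ptopologicalType) :=
  Pointed.copy (prod_topology X) (forall i, X i).

(* Two terms of type 'Pr T R' may differ on non-measurable sets, where their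
   values are junk: equality of measures is 'ceq' below, never '='. *)
Notation Pr T R := (probability (borel T) R).
Notation signed T R := (charge (borel T) R).

Section measurability.

Lemma continuous_borel (T U : ptopologicalType) (f : T -> U) :
  continuous f -> measurable_fun [set: borel T] (f : borel T -> borel U).
Proof.
move=> cf; apply: (measurability (@open U : set (set (borel U)))) => // _ [A oA <-].
rewrite setTI; apply: sub_sigma_algebra.
by apply: (open_comp _ oA) => x _; exact: cf.
Qed.

Lemma prod_cvgP (I : Type) (X : I -> topologicalType)
    (F : set_system (prod_topology X)) (x : prod_topology X) : Filter F ->
  (forall i A, nbhs (x i) A -> F [set y | A (y i)]) -> F --> x.
Proof.
move=> FF Fx; apply/cvg_sup => i A /=.
rewrite (@nbhsE (initial_topology _)) => -[_ [[B oB <-] Bx] BA].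
apply: (@filterS _ F _ _ _ BA); apply: (Fx i B).
by apply: open_nbhs_nbhs; split.
Qed.

Lemma continuous_prod (I : Type) (T : topologicalType)
    (X : I -> topologicalType) (f : T -> prod_topology X) :
  (forall i, continuous (fun x => f x i)) -> continuous f.
Proof. by move=> cf x; apply: prod_cvgP => i A Ax; exact: (cf i x A). Qed.

Variables (R : realType) (X : polishType R).

Lemma polish_countable_basis : exists B : nat * nat -> set X,
  (forall n, open (B n)) /\
  (forall x A, nbhs x A -> exists2 n, B n x & B n `<=` A).
Proof.
have [[D cD dD] [d [dE dC dT nbhsd _]]] := @polishP R X.
have d0 x : d x x = 0 by exact/(proj2 (proj2 (dE x x))).
have oball x e : open [set y | d x y < e].
  rewrite openE => y /= xye; apply/nbhsd.
  exists (e - d x y) => [|z /= yz]; first by rewrite subr_gt0.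
  by rewrite (le_lt_trans (dT x y z))// -ltrBrDl.
have [i iinj] : exists i : X -> nat, {in D &, injective i}.
  by case/pcard_leP: cD => f; exists f; exact: inj.
exists (fun n => [set y | exists x, [/\ D x, i x = n.1 & d x y < (n.2).+1%:R^-1]]).
split=> [[n m]|x A /nbhsd[e e0 eA]].
  rewrite openE => y /= [x [Dx xn xy]]; rewrite /interior.
  apply: filterS (open_nbhs_nbhs (conj (oball x (m.+1%:R^-1)) xy)).
  by move=> z /= xz; exists x.
have ballxx m : d x x < m.+1%:R^-1 by rewrite d0 invr_gt0 ltr0Sn.
have [m me] : exists m : nat, m.+1%:R^-1 < e / 2.
  have := @near_infty_natSinv_lt R (PosNum (divr_gt0 e0 (ltr0n R 2))).
  by move=> [m _ /(_ m (leqnn m))]; exists m.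
have [y [xy Dy]] := dD [set y | d x y < m.+1%:R^-1]
  (ex_intro _ x (ballxx m)) (oball _ _).
exists (i y, m); first by exists y; split => //=; rewrite dC.
move=> z [x' [Dx' ix' x'z]]; apply: eA => /=.
have x'y : x' = y by apply: iinj => //; exact/mem_set.
rewrite x'y in x'z.
rewrite (le_lt_trans (dT x y z))// (splitr e) ltrD//.
  exact: lt_trans me.
exact: lt_trans me.
Qed.

Lemma measurable_Xpow d (T : measurableType d) k (f : T -> Xpow X k) :
  (forall i, measurable_fun [set: T] (fun t => f t i : borel X)) ->
  measurable_fun [set: T] (f : T -> borel (Xpow X k)).
Proof.
move=> mf; have [B [oB Bx]] := polish_countable_basis.
apply: (measurability (@open _ : set (set (borel (Xpow X k))))) => // _ [V oV <-].
rewrite setTI.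
pose box (n : {ffun 'I_k -> nat * nat}) : set (Xpow X k) :=
  [set x | forall i, B (n i) (x i)].
have -> : V = \bigcup_(n in [set n | box n `<=` V]) box n.
  apply/seteqP; split=> [x Vx|x [n nV]]; last exact: nV.
  pose G : set_system (Xpow X k) :=
    [set A | exists2 n, box n x & box n `<=` A].
  have mergeP (n1 n2 : {ffun 'I_k -> nat * nat}) : box n1 x -> box n2 x ->
      exists2 n, box n x & box n `<=` box n1 `&` box n2.
    move=> n1x n2x.
    have /choice[n nP] i : exists m, B m (x i) /\ B m `<=` B (n1 i) `&` B (n2 i).
      have [|m mx mB] := Bx (x i) (B (n1 i) `&` B (n2 i)).
        by apply: filterI; apply: open_nbhs_nbhs.
      by exists m.
    exists [ffun i => n i]; first by move=> i; rewrite ffunE; have [] := nP i.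
    by move=> y yn; split => i; have := yn i; rewrite ffunE => /(proj2 (nP i))[].
  have one i A : nbhs (x i) A ->
      exists2 n, box n x & box n `<=` [set y | A (y i)].
    move=> Ax.
    have /choice[n nP] j : exists m, B m (x j) /\ (i = j -> B m `<=` [set y | A y]).
      have [ij|ij] := pselect (i = j).
        by case: _ / ij; have [m mx mA] := Bx (x i) A Ax; exists m.
      by have [m mx _] := Bx (x j) setT filterT; exists m.
    exists [ffun i => n i]; first by move=> j; rewrite ffunE; have [] := nP j.
    by move=> y /(_ i); rewrite ffunE; exact: (proj2 (nP i)).
  have FG : Filter G.
    split.
    - have /choice[n nP] j : exists m, B m (x j).
        by have [m mx _] := Bx (x j) setT filterT; exists m.
      by exists [ffun i => n i] => // i; rewrite ffunE.
    - move=> P Q [n1 n1x n1P] [n2 n2x n2Q].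
      have [n nx nB] := mergeP _ _ n1x n2x; exists n => // y /nB[? ?].
      by split; [exact: n1P|exact: n2Q].
    - by move=> P Q PQ [n nx nP]; exists n => // y /nP /PQ.
  have [n nx nV] := @prod_cvgP _ _ G x FG one V (open_nbhs_nbhs (conj oV Vx)).
  by exists n.
rewrite preimage_bigcup bigcup_mkcond.
apply: countable_bigcupT_measurable => [|n]; first exact: countableP.
case: ifPn => // _.
rewrite (_ : f @^-1` box n = \bigcap_(i in [set: 'I_k]) (fun t => f t i) @^-1` B (n i)).
  apply: fin_bigcap_measurable => // i _; rewrite -[X in measurable X]setTI.
  by apply: mf => //; apply: sub_sigma_algebra.
by apply/seteqP; split=> [t ft i _|t ft i]; [exact: ft|exact: ft].
Qed.

End measurability.

Section narrow.
Variables (R : realType) (T : ptopologicalType).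

Definition bounded_continuous (phi : T -> R) : Prop :=
  continuous phi /\ [bounded phi x | x in [set: T]].

Definition narrow_eval (mu : Pr T R) :
    prod_topology (fun _ : {phi : T -> R | bounded_continuous phi} => R) :=
  fun phi => (\int[mu]_x sval phi x)%R.

(* The coarsest topology on 'Pr T R' for which integration against every
   bounded continuous function is continuous. *)
Definition narrow : Type := initial_topology narrow_eval.
HB.instance Definition _ := PointedTopological.on narrow.

End narrow.

Section signed_measures.
Variables (R : realType) (T : ptopologicalType).
Implicit Types (mu nu : signed T R).

Definition ceq (mu nu : set (borel T) -> \bar R) : Prop :=
  forall A, measurable A -> mu A = nu A.

Definition tv (mu nu : set (borel T) -> \bar R) : \bar R :=
  ereal_sup [set `|mu A - nu A|%E | A in measurable].

Definition of_prob (P : Pr T R) : signed T R := charge_of_finite_measure P.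

Definition zerom : signed T R := czero.
Definition addm mu nu : signed T R := cadd mu nu.
Definition scalem (a : R) mu : signed T R := cscale a mu.

Lemma hahn_exists nu :
  exists D : set (borel T) * set (borel T), hahn_decomposition nu D.1 D.2.
Proof. by have [P [N PN]] := Hahn_decomposition nu; exists (P, N). Qed.

(* The Jordan decomposition does not depend on the chosen Hahn decomposition. *)
Definition cintegral nu (phi : T -> R) : \bar R :=
  let D := projT2 (cid (hahn_exists nu)) in
  (\int[jordan_pos D]_x (phi x)%:E - \int[jordan_neg D]_x (phi x)%:E)%E.

End signed_measures.
Arguments zerom {R T}.

Section pushforward.
Variables (R : realType) (T U : ptopologicalType).
Variables (nu : signed T R) (f : {mfun borel T >-> borel U}).

Definition push_charge : set (borel U) -> \bar R := pushforward nu f.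

Let mpre A : measurable A -> measurable (f @^-1` A).
Proof. by move=> mA; rewrite -[X in measurable X]setTI; exact: measurable_funPT. Qed.

Let push0 : push_charge set0 = 0%E.
Proof. by rewrite /push_charge /pushforward preimage_set0 charge0. Qed.

Let push_fin A : measurable A -> push_charge A \is a fin_num.
Proof. by move=> /mpre; exact: (@fin_num_measure _ _ _ nu). Qed.

Let push_sigma_additive : semi_sigma_additive push_charge.
Proof.
move=> F mF tF mUF; rewrite /push_charge /pushforward preimage_bigcup.
apply: charge_semi_sigma_additive.
- by move=> n; exact: mpre.
- apply/trivIsetP => /= i j _ _ ij; rewrite -preimage_setI.
  by move/trivIsetP : tF => /(_ _ _ _ _ ij) ->//; rewrite preimage_set0.
- by rewrite -preimage_bigcup; exact: mpre.
Qed.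

HB.instance Definition _ := isCharge.Build _ _ _ push_charge
  push0 push_fin push_sigma_additive.

Definition pushm : signed U R := push_charge.

End pushforward.

Section reindexing.
Variable X : ptopologicalType.

Definition reindex a b (f : 'I_b -> 'I_a) : borel (Xpow X a) -> borel (Xpow X b) :=
  fun x i => x (f i).
Arguments reindex {a b} f.

Lemma measurable_reindex a b (f : 'I_b -> 'I_a) :
  measurable_fun [set: borel (Xpow X a)]
    (reindex f : borel (Xpow X a) -> borel (Xpow X b)).
Proof.
by apply: continuous_borel; apply: continuous_prod => i; exact: proj_continuous.
Qed.

HB.instance Definition _ a b (f : 'I_b -> 'I_a) :=
  isMeasurableFun.Build _ _ (borel (Xpow X a)) (borel (Xpow X b))
    (reindex f) (measurable_reindex f).

Definition reindexm a b (f : 'I_b -> 'I_a) :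
  {mfun borel (Xpow X a) >-> borel (Xpow X b)} := reindex f.

Definition diag m : borel X -> borel (Xpow X m) := fun x _ => x.
Arguments diag : clear implicits.

Lemma measurable_diag m : measurable_fun [set: borel X]
  (diag m : borel X -> borel (Xpow X m)).
Proof.
by apply: continuous_borel; apply: continuous_prod => i x A.
Qed.

HB.instance Definition _ m :=
  isMeasurableFun.Build _ _ (borel X) (borel (Xpow X m))
    (diag m) (@measurable_diag m).

Definition diagm m : {mfun borel X >-> borel (Xpow X m)} := diag m.

Definition catX a b (xy : borel (Xpow X a) * borel (Xpow X b)) :
    borel (Xpow X (a + b)) :=
  fun i => match fintype.split i with inl j => xy.1 j | inr j => xy.2 j end.

End reindexing.
Arguments reindex X {a b} f.
Arguments reindexm X {a b} f.
Arguments diag : clear implicits.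
Arguments diagm : clear implicits.
Arguments catX {X a b} xy.

Section measurable_cat.
Variables (R : realType) (X : polishType R) (a b : nat).

(* The domain carries the product of the two Borel sigma-algebras: this is
   where the countable basis of X is used. *)
Lemma measurable_catX :
  measurable_fun [set: (borel (Xpow X a) * borel (Xpow X b))%type]
    (@catX X a b : borel (Xpow X a) * borel (Xpow X b) ->
                   borel (Xpow X (a + b))).
Proof.
apply: measurable_Xpow => i; rewrite /catX; case: (fintype.split i) => j.
- apply: (@measurableT_comp _ _ _ _ _ _ (fun x : borel (Xpow X a) => x j : borel X)).
    by apply: continuous_borel; exact: proj_continuous.
  exact: measurable_fst.
- apply: (@measurableT_comp _ _ _ _ _ _ (fun x : borel (Xpow X b) => x j : borel X)).
    by apply: continuous_borel; exact: proj_continuous.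
  exact: measurable_snd.
Qed.

HB.instance Definition _ :=
  isMeasurableFun.Build _ _
    (borel (Xpow X a) * borel (Xpow X b))%type (borel (Xpow X (a + b)))
    (@catX X a b) measurable_catX.

Definition catm : {mfun (borel (Xpow X a) * borel (Xpow X b))%type >->
                        borel (Xpow X (a + b))} := @catX X a b.

End measurable_cat.

Section symmetrization.
Variables (R : realType) (X : ptopologicalType) (k : nat).

(* \gamma^\sigma is the push-forward under x |-> (x_{\sigma(1)}, ...). *)
Definition symm (nu : signed (Xpow X k) R) : signed (Xpow X k) R :=
  scalem (k`!%:R^-1) (\big[@addm R _/zerom]_(s : 'S_k) pushm nu (reindexm X s)).

End symmetrization.

Section representability.
Variables (R : realType) (X : ptopologicalType).

Definition marginal N k (hk : (k <= N)%N) (g : Pr (Xpow X N) R) :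
    Pr (Xpow X k) R :=
  distribution g (reindexm X (widen_ord hk)).

Definition N_representable N k (hk : (k <= N)%N) (mu : Pr (Xpow X k) R) : Prop :=
  exists2 g : Pr (Xpow X N) R,
    ceq (symm (of_prob g)) g & ceq mu (marginal hk g).

(* 'ceq' rather than '=': the set must be saturated under changing measures on
   non-measurable sets, otherwise it would not be Borel. *)
Definition empirical N : set (narrow R X) :=
  [set l : Pr X R | exists x : 'I_N -> borel X,
     ceq l (fun A => (N%:R^-1)%:E * \sum_(i < N) \d_(x i) A)%E].

End representability.

Section tensors.
Variables (R : realType) (X : polishType R).

Definition tensor a b (mu : Pr (Xpow X a) R) (nu : Pr (Xpow X b) R) :
    Pr (Xpow X (a + b)) R :=
  distribution (mu \x nu)%E (catm X a b).

Definition cast_pow a b (e : a = b) (mu : Pr (Xpow X a) R) : Pr (Xpow X b) R :=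
  distribution mu (reindexm X (cast_ord (esym e))).

(* The unit of 'tensor': the only probability measure on the one-point X^0. *)
Definition unit_pow : Pr (Xpow X 0) R := dirac (point : borel (Xpow X 0)).

Definition diag_push m (l : Pr X R) : Pr (Xpow X m) R := distribution l (diagm X m).

Fixpoint power (l : Pr X R) m : Pr (Xpow X m) R :=
  if m is m'.+1 then tensor (diag_push 1 l) (power l m') else unit_pow.

Fixpoint diag_blocks (l : Pr X R) (s : seq nat) : Pr (Xpow X (sumn s)) R :=
  if s is m :: s' then tensor (diag_push m l) (diag_blocks l s') else unit_pow.

End tensors.

Section partitions.

Definition is_partition (j : nat) (p : seq nat) : bool :=
  [&& sorted geq p, all (leq 1) p & sumn p == j].

Definition kpartition k j : finType :=
  {p : k.-bseq 'I_j.+1 |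
    is_partition j [seq nat_of_ord q | q <- p] && (j + size p <= k)%N}.

Definition parts k j (p : kpartition k j) : seq nat :=
  [seq nat_of_ord q | q <- val p].

Lemma sumn_blocks k j (p : kpartition k j) :
  (sumn [seq q.+1 | q <- parts p] + (k - j - size (parts p)) = k)%N.
Proof.
rewrite /parts; case: p => p /= /andP[/and3P[_ _ /eqP ps] pk].
have sumS s : sumn [seq q.+1 | q <- s] = (sumn s + size s)%N.
  by elim: s => //= q s ->; rewrite addSn addnS addnA.
by rewrite sumS ps size_map -subnDA subnKC.
Qed.

Definition d_coef (R : realType) k j (p : seq nat) : R :=
  k`!%:R / (k - j - size p)`!%:R *
  (\prod_(q <- p) q.+1%:R^-1) *
  (\prod_(q <- undup p) ((count_mem q p)`!%:R)^-1).

End partitions.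

Section expansion.
Variables (R : realType) (X : polishType R).

Definition P_term k j (l : Pr X R) (p : kpartition k j) : Pr (Xpow X k) R :=
  cast_pow (sumn_blocks p)
    (tensor (diag_blocks l [seq q.+1 | q <- parts p])
            (power l (k - j - size (parts p)))).

Definition P_poly k j (l : Pr X R) : signed (Xpow X k) R :=
  \big[@addm R _/zerom]_(p : kpartition k j)
    scalem (d_coef R k j (parts p)) (of_prob (P_term l p)).

(* The expansion truncated after the term j = p. *)
Definition F_trunc N k p (l : Pr X R) : signed (Xpow X k) R :=
  scalem (N%:R ^+ k.-1 / \prod_(1 <= i < k) (N%:R - i%:R))
    (addm (of_prob (power l k))
       (\big[@addm R _/zerom]_(1 <= j < p.+1)
          scalem ((-1) ^+ j / N%:R ^+ j) (symm (P_poly k j l)))).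

Definition F_full N k (l : Pr X R) : signed (Xpow X k) R := F_trunc N k k.-1 l.

(* 'nu is the integral of G over D', tested against bounded continuous phi;
   for metrizable U this determines nu on Borel sets. *)
Definition is_integral (U : ptopologicalType) (alpha : Pr (narrow R X) R)
    (D : set (narrow R X)) (G : Pr X R -> signed U R) (nu : signed U R) : Prop :=
  forall phi : U -> R, bounded_continuous phi ->
    cintegral nu phi = (\int[alpha]_(l in D) cintegral (G l) phi)%E.

End expansion.

(* Main.v *)
Require Import Defs.
From HB Require Import structures.
From mathcomp Require Import all_boot all_order all_algebra all_fingroup.
From mathcomp Require Import all_classical all_reals all_analysis.
From mathcomp Require Import measurable_realfun giry.
From mathcomp Require Import ring lra.

Set Implicit Arguments.
Unset Strict Implicit.
Unset Printing Implicit Defensive.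

Import Order.TTheory GRing.Theory Num.Theory.
Import numFieldNormedType.Exports.

Local Open Scope classical_set_scope.
Local Open Scope ring_scope.

(* The truncated and the full expansion differ by the terms p < j < k, whose
   total variation is bounded, uniformly in lambda, by a constant depending on k
   times N^-(p+1); the prefactor is at most k^(k-1) because N <= k (N - i) for
   i < k <= N. Integrating against alpha gives the estimate once the mixtures
   are known to exist as signed measures and mu_k to coincide with the mixture
   of the full expansion.

   Existence: lambda |-> lambda(A) is Borel for the narrow topology, so the
   expansions are finite real combinations of Markov kernels, and these can be
   integrated one by one.

   Coincidence: indicators of open subsets of X are limits of continuous
   [0,1]-valued functions, so charges on X^k with the same integrals of bounded
   continuous functions agree on a generating pi-system. The given integral runs
   over the empirical measures only; to extend it to P(X) one needs this set to
   be Borel. A probability measure is empirical if and only if it takes values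
   in {0, 1/N, ..., 1} on the finite intersections of a countable basis: such a
   measure takes these values on all Borel sets, and point masses 1/N can then be
   split off one after the other. *)

(** * Limits of continuous functions and Borel sets *)

Section indicator_limits.
Variable R : realType.

(** The sets on which integrals of bounded continuous functions determine a measure, by dominated
    convergence. The bounds 0 and 1 serve as domination and are stable under products, so these sets
    form a pi-system. *)
Definition indicator_limit (T : topologicalType) (A : set T) : Prop :=
  exists f : nat -> T -> R, [/\ forall n, continuous (f n),
    forall n x, 0 <= f n x <= 1 & forall x, f n x @[n --> \oo] --> (\1_A x : R)].

Lemma indicator_limitT (T : topologicalType) : indicator_limit [set: T].
Proof.
exists (fun _ _ => 1); split => [n x|n x|x]; first exact: cvg_cst.
- by rewrite ler01 lexx.
- by rewrite indicT; exact: cvg_cst.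
Qed.

Lemma indicator_limitI (T : topologicalType) : setI_closed (@indicator_limit T).
Proof.
move=> A B [f [fc f01 fA]] [g [gc g01 gB]].
exists (fun n => f n \* g n); split => [n x|n x|x].
- by apply: cvgM; [exact: fc|exact: gc].
- have /andP[f0 f1] := f01 n x; have /andP[g0 g1] := g01 n x.
  by rewrite /= mulr_ge0//= mulr_ile1.
- by rewrite indicI; exact: cvgM.
Qed.

Lemma indicator_limit_preimage (T U : topologicalType) (g : T -> U) (A : set U) :
  continuous g -> indicator_limit A -> indicator_limit (g @^-1` A).
Proof.
move=> gc [f [fc f01 fA]]; exists (fun n => f n \o g); split => [n x|n x|x].
- by apply: continuous_comp; [exact: gc|exact: fc].
- exact: f01.
- exact: fA.
Qed.

(** The approximants are min(n r(x), 1), where r is the distance to the complement of A: r vanishes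
    off A and is positive on A. *)
Lemma open_indicator_limit (X : polishType R) (A : set X) :
  open A -> indicator_limit A.
Proof.
move=> oA; have [d [dE dC dT nbhsd _]] := (@polishP R X).2.
(* For A the whole space, r would be the infimum of an empty set, which is 0 by default, so this
   case is treated apart. *)
have [[y0 y0A]|AT] := pselect (~` A !=set0); last first.
  suff -> : A = setT by exact: indicator_limitT.
  by apply/seteqP; split => // x _; apply: contrapT => nAx; apply: AT; exists x.
have d0 x : d x x = 0 by exact/(proj2 (proj2 (dE x x))).
pose D x := [set d x y | y in ~` A].
pose r x := inf (D x).
have hD x : has_inf (D x).
  split; first by exists (d x y0), y0.
  by exists 0 => _ [y _ <-]; have [] := dE x y.
have r_ge0 x : 0 <= r x.
  by apply: lb_le_inf => [|_ [y _ <-]]; [exact: (hD x).1|have [] := dE x y].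
have rD x y : r x <= d x y + r y.
  rewrite -lerBlDl; apply: lb_le_inf => [|_ [z nAz <-]]; first exact: (hD y).1.
  rewrite lerBlDl (le_trans _ (dT x y z))//; apply: ge_inf; last by exists z.
  exact: (hD x).2.
have rc : continuous r.
  move=> x; apply/cvgrPdist_lt => e e0; apply/nbhsd; exists e => // y /= xye.
  rewrite ltr_norml ltrBlDr (le_lt_trans (rD x y)) ?ltrD2r// andbT.
  by rewrite ltrBrDl ltrBlDr (le_lt_trans (rD y x))// dC addrC ltrD2l.
exists (fun n => (fun x => n%:R * r x) \min cst 1); split => [n x|n x|x].
- apply: continuous_min; last exact: cvg_cst.
  by apply: cvgM; [exact: cvg_cst|exact: rc].
- by rewrite /= le_min ler01 ge_min lexx orbT mulr_ge0.
- have [Ax|nAx] := pselect (A x); last first.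
    rewrite indicE memNset//= [X in X @ _ --> _](_ : _ = fun=> 0); first exact: cvg_cst.
    apply/funext => n; have -> : r x = 0; last by rewrite mulr0 min_l.
    apply/eqP; rewrite eq_le r_ge0 andbT; apply: ge_inf; first exact: (hD x).2.
    by exists x.
  have /nbhsd[e e0 eA] : nbhs x A by apply: open_nbhs_nbhs.
  have re : e <= r x.
    apply: lb_le_inf => [|_ [y nAy <-]]; first exact: (hD x).1.
    by rewrite leNgt; apply/negP => /eA.
  rewrite indicE mem_set//=; apply: cvg_near_cst.
  have [m _ mP] := near_infty_natSinv_lt (PosNum e0).
  near=> n; apply/eqP; rewrite min_r//.
  have n_gt : (m < n)%N by near: n; exact: nbhs_infty_gt.
  have n0 : 0 < n%:R :> R by rewrite ltr0n (leq_ltn_trans _ n_gt).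
  rewrite -ler_pdivrMl// mulr1 (le_trans _ re)//.
  (* [mP] bounds the inverse of a successor, hence its use at [n.-1]. *)
  have := mP n.-1; rewrite /= (ltn_predK n_gt) => h; apply/ltW/h.
  by rewrite -ltnS (ltn_predK n_gt).
Unshelve. all: by end_near. Qed.

(** No metric on the power is needed: the identity into the Borel space is measurable as soon as its
    coordinates are, and the preimage of an open set under a projection is an indicator limit. *)
Lemma open_Xpow_indicator_limit (X : polishType R) k (V : set (Xpow X k)) :
  open V -> <<s @indicator_limit (Xpow X k) >> V.
Proof.
move=> oV; pose G := @indicator_limit (Xpow X k).
have : measurable_fun [set: g_sigma_algebraType G]
    (id : g_sigma_algebraType G -> borel (Xpow X k)).
  apply: measurable_Xpow => i.
  apply: (measurability (@open X : set (set (borel X)))) => // _ [A oA <-].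
  rewrite setTI; apply: sub_sigma_algebra.
  apply: indicator_limit_preimage (open_indicator_limit oA).
  exact: proj_continuous.
move=> /(_ measurableT V); rewrite setTI; apply.
exact: sub_sigma_algebra.
Qed.

End indicator_limits.

(** * Integration against charges *)

Lemma bounded_le (T : Type) (R : realType) (f : T -> R) (M : R) :
  (forall x, `|f x| <= M) -> [bounded f x | x in [set: T]].
Proof.
move=> fM; exists M; split; first exact: num_real.
by move=> y yM x _; rewrite /= (le_trans (fM x))// ltW.
Qed.

Section linear_combinations.
Context d (T : measurableType d) (R : realType).

Lemma nonneg_combination (I : finType) (a : I -> R)
    (P : I -> {measure set T -> \bar R}) : (forall i, 0 <= a i) ->
  exists m : {measure set T -> \bar R},
    (forall A, m A = \sum_i (a i)%:E * P i A)%E /\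
    (forall f : T -> \bar R, (forall x, 0 <= f x)%E ->
      measurable_fun [set: T] f ->
      \int[m]_x f x = \sum_i (a i)%:E * \int[P i]_x f x)%E.
Proof.
move=> a0; elim: (index_enum I) => [|i s [m [mE mI]]].
  exists mzero; split=> [A|f f0 mf]; first by rewrite big_nil.
  by rewrite big_nil integral_measure_zero.
exists (measure_add (mscale (NngNum (a0 i)) (P i)) m); split=> [A|f f0 mf].
  by rewrite [LHS]measure_addE big_cons mE.
by rewrite ge0_integral_measure_add// ge0_integral_mscale// big_cons mI.
Qed.

Lemma bounded_integrable (m : {finite_measure set T -> \bar R}) (f : T -> R) :
  measurable_fun [set: T] f -> [bounded f x | x in [set: T]] ->
  m.-integrable [set: T] (EFin \o f).
Proof.
move=> mf bf; apply: measurable_bounded_integrable => //.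
by rewrite ltey_eq fin_num_measure.
Qed.

Lemma bounded_EFin_Rintegral (m : {finite_measure set T -> \bar R}) (f : T -> R) :
  measurable_fun [set: T] f -> [bounded f x | x in [set: T]] ->
  (\int[m]_x (f x)%:E = (\int[m]_x f x)%R%:E)%E.
Proof.
by move=> mf bf; rewrite /Rintegral fineK// integrable_fin_num//; exact: bounded_integrable.
Qed.

(** Separating positive and negative coefficients gives two positive measures that agree on
    measurable sets, hence have the same integrals of nonnegative functions. A bounded f becomes
    nonnegative after adding a constant. *)
Lemma vanishing_combination (I : finType) (c : I -> R)
    (P : I -> {finite_measure set T -> \bar R}) (f : T -> R) :
  (forall A, measurable A -> \sum_i (c i)%:E * P i A = 0)%E ->
  measurable_fun [set: T] f -> [bounded f x | x in [set: T]] ->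
  \sum_i c i * \int[P i]_x f x = 0.
Proof.
move=> cP0 mf bf.
pose cp i := Num.max (c i) 0; pose cn i := Num.max (- c i) 0.
have cE i : c i = cp i - cn i by rewrite /cp /cn; case: leP => ?; case: leP => ?; lra.
have [mp [mpE mpI]] := @nonneg_combination I cp P
  (fun i => ltac:(by rewrite /cp le_max lexx orbT)).
have [mn [mnE mnI]] := @nonneg_combination I cn P
  (fun i => ltac:(by rewrite /cn le_max lexx orbT)).
have sumE (v : I -> R) : (\sum_i (cp i)%:E * (v i)%:E = \sum_i (cn i)%:E * (v i)%:E)%E <->
    \sum_i c i * v i = 0.
  under eq_bigr do rewrite -EFinM.
  under [in X in _ = X]eq_bigr do rewrite -EFinM.
  rewrite !sumEFin; under [in X in _ <-> X]eq_bigr do rewrite cE mulrBl.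
  rewrite sumrB; split=> [[->]|/eqP]; first by rewrite subrr.
  by rewrite subr_eq0 => /eqP ->.
have mpn A : measurable A -> mp A = mn A.
  move=> mA; rewrite mpE mnE.
  have PE i : P i A = (fine (P i A))%:E by rewrite fineK// fin_num_measure.
  rewrite (eq_bigr (fun i => (cp i)%:E * (fine (P i A))%:E)%E) => [|i _]; last by rewrite -PE.
  rewrite [RHS](eq_bigr (fun i => (cn i)%:E * (fine (P i A))%:E)%E) => [|i _]; last by rewrite -PE.
  apply/sumE; have := cP0 _ mA.
  under eq_bigr do rewrite PE -EFinM.
  by rewrite sumEFin => -[].
have key (g : T -> R) : (forall x, 0 <= g x) -> measurable_fun [set: T] g ->
    [bounded g x | x in [set: T]] -> \sum_i c i * \int[P i]_x g x = 0.
  move=> g0 mg bg; apply/sumE.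
  have : (\int[mp]_x (g x)%:E = \int[mn]_x (g x)%:E)%E.
    by apply: eq_measure_integral => A mA _; exact: mpn.
  have g0' x : (0 <= (g x)%:E)%E by rewrite lee_fin.
  rewrite mpI//; last exact/measurable_EFinP.
  rewrite mnI//; last exact/measurable_EFinP.
  under eq_bigr do rewrite bounded_EFin_Rintegral//.
  by under [in RHS]eq_bigr do rewrite bounded_EFin_Rintegral//.
(* Boundedness only provides bounds strictly above [M0], whence the added 1. *)
have [M0 [_ M0f]] := bf; pose M := `|M0| + 1.
have fM x : `|f x| <= M by apply: M0f => //; rewrite /M ltr_pwDr// ler_norm.
have bfM : [bounded f x + M | x in [set: T]].
  apply: (@bounded_le _ _ _ (M + M)) => x; rewrite (le_trans (ler_normD _ _))//.
  by rewrite lerD// ger0_norm// (le_trans (normr_ge0 (f x))).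
have bM : [bounded (fun=> M : R) x | x in [set: T]].
  exact: (@bounded_le _ _ _ `|M|).
have mfM : measurable_fun [set: T] (fun x => f x + M) by apply: measurable_funD.
rewrite (eq_bigr (fun i => c i * \int[P i]_x (f x + M) - c i * \int[P i]_x (fun=> M) x)).
  rewrite sumrB !key ?subrr// => x; last by have := fM x; rewrite ler_norml; lra.
  by rewrite (le_trans (normr_ge0 (f x))).
move=> i _; rewrite -mulrBr -RintegralB//; [|exact: bounded_integrable..].
by congr (_ * _); apply: eq_Rintegral => x _; rewrite addrK.
Qed.

End linear_combinations.

Section charge_integral.
Variables (R : realType) (T : ptopologicalType).

Lemma continuous_measurable (f : T -> R) :
  continuous f -> measurable_fun [set: borel T] f.
Proof.
move=> /continuousP cf; apply: (measurability _ (RGenOpens.measurableE R)).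
move=> _ [_ [a [b ->] <-]]; rewrite setTI; apply: sub_sigma_algebra.
by apply: cf; exact: interval_open.
Qed.

(** Frees [cintegral] from the chosen Hahn decomposition: the positive part minus the negative part
    minus the given combination is a vanishing combination. *)
Lemma cintegral_combination (nu : signed T R) (I : finType) (c : I -> R)
    (P : I -> {finite_measure set (borel T) -> \bar R}) (phi : T -> R) :
  (forall A, measurable A -> nu A = \sum_i (c i)%:E * P i A)%E ->
  measurable_fun [set: borel T] phi -> [bounded phi x | x in [set: T]] ->
  cintegral nu phi = (\sum_i c i * \int[P i]_x phi x)%:E.
Proof.
move=> nuE mphi bphi; rewrite /cintegral /=.
set D := svalP _.
rewrite !bounded_EFin_Rintegral//=.
(* The boolean indexes the Jordan parts: [false] the positive one with sign 1, [true] the negative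
   one with sign -1. *)
pose c' (j : bool + I) := match j with inl b => (-1) ^+ b | inr i => - c i end.
pose P' (j : bool + I) : {finite_measure set (borel T) -> \bar R} :=
  match j with inl true => jordan_neg D | inl false => jordan_pos D | inr i => P i end.
have := @vanishing_combination _ _ R _ c' P' phi _ mphi bphi.
rewrite !big_sumType !big_bool /= expr1 expr0 mulN1r mul1r.
rewrite (eq_bigr (fun i => - (c i * \int[P i]_x phi x))); last by move=> *; rewrite mulNr.
rewrite sumrN => h; congr EFin; apply/eqP; rewrite -subr_eq0 [X in X - _]addrC; apply/eqP/h.
move=> A mA; rewrite big_sumType big_bool /= expr1 expr0 mul1e.
have := jordan_decomp D mA; rewrite nuE// /cadd /= /cscale => E.
rewrite (addeC (_ * _)%E) -E.
under [X in (_ + X)%E]eq_bigr do rewrite EFinN mulNe.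
rewrite sumeN; last first.
  by move=> i j _ _; rewrite fin_num_adde_defl// fin_numM// fin_num_measure.
rewrite subee//; apply/sum_fin_numP => i _ _.
by rewrite fin_numM// fin_num_measure.
Qed.

End charge_integral.

(** * Charges and narrow measurability tested by continuous functions *)

Section borel_generation.
Variable R : realType.

Lemma prod_eval_continuous (I : Type) (K : I -> topologicalType) (i : I) :
  continuous (fun g : prod_topology K => g i).
Proof.
move=> g A Ag; have /cvg_sup/(_ i) : nbhs g --> g by exact: cvg_id.
by apply; exact: (@initial_continuous _ _ (fun g : forall i, K i => g i)).
Qed.

Lemma indicator_limit_measurable (T : ptopologicalType) (A : set T) :
  indicator_limit R A -> measurable (A : set (borel T)).
Proof.
move=> [f [fc _ fA]]; apply/(@measurable_indicP _ (borel T) R).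
apply: (@measurable_fun_cvg _ (borel T) R _ f) => // n.
exact: continuous_measurable.
Qed.

Lemma borel_indicator_limit (T : ptopologicalType) :
  (forall V : set T, open V -> <<s @indicator_limit R T >> V) ->
  (measurable : set (set (borel T))) = <<s @indicator_limit R T >>.
Proof.
move=> gen; apply/seteqP; split; apply: smallest_sub.
- exact: smallest_sigma_algebra.
- exact: gen.
- exact: (@sigma_algebra_measurable _ (borel T)).
- by move=> A; exact: indicator_limit_measurable.
Qed.

Lemma borel_polish (X : polishType R) :
  (measurable : set (set (borel X))) = <<s @indicator_limit R X >>.
Proof.
apply: borel_indicator_limit => V oV.
by apply: sub_sigma_algebra; exact: open_indicator_limit.
Qed.

Lemma borel_Xpow (X : polishType R) k :
  (measurable : set (set (borel (Xpow X k)))) = <<s @indicator_limit R (Xpow X k) >>.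
Proof. by apply: borel_indicator_limit; exact: open_Xpow_indicator_limit. Qed.

Lemma unit_bounded (T : Type) (f : T -> R) :
  (forall x, 0 <= f x <= 1) -> [bounded f x | x in [set: T]].
Proof.
move=> f01; apply: (@bounded_le _ _ _ 1) => x.
by have /andP[f0 f1] := f01 x; rewrite ger0_norm.
Qed.

Lemma indicator_limit_Rintegral (T : ptopologicalType) (A : set T)
    (m : {finite_measure set (borel T) -> \bar R}) (f : nat -> T -> R) :
  (forall n, continuous (f n)) -> (forall n x, 0 <= f n x <= 1) ->
  (forall x, f n x @[n --> \oo] --> (\1_A x : R)) ->
  \int[m]_x f n x @[n --> \oo] --> fine (m A).
Proof.
move=> fc f01 fA.
have mA : measurable (A : set (borel T)).
  by apply: indicator_limit_measurable; exists f.
have mf n : measurable_fun [set: borel T] (fun x => (f n x)%:E).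
  by apply/measurable_EFinP; exact: continuous_measurable.
have m1 : measurable_fun [set: borel T] (fun x => (\1_A x : R)%:E).
  by apply/measurable_EFinP; exact: measurable_indic.
have [|||_ _] := @dominated_convergence _ (borel T) R m setT measurableT
  (fun n x => (f n x)%:E) (fun x => (\1_A x)%:E) (fun=> 1%E) mf m1.
- by apply: aeW => x _; apply: cvg_EFin; [exact: nearW|exact: fA].
- exact: finite_measure_integrable_cst.
- apply: aeW => x n _; have /andP[f0 f1] := f01 n x.
  by rewrite /= lee_fin ger0_norm.
rewrite integral_indic// setIT => h.
by apply: fine_cvg; rewrite fineK ?fin_num_measure.
Qed.

(** On an indicator limit both charges are limits of the same integrals, by dominated convergence
    for each Jordan part. Dynkin's argument carries the equality to the generated sigma-algebra. *)
Lemma charge_eq_of_cintegral (T : ptopologicalType) (nu1 nu2 : signed T R) :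
  (measurable : set (set (borel T))) = <<s @indicator_limit R T >> ->
  (forall phi : T -> R, bounded_continuous phi ->
    cintegral nu1 phi = cintegral nu2 phi) ->
  ceq nu1 nu2.
Proof.
move=> gen nu12.
have key A : indicator_limit R A -> nu1 A = nu2 A.
  move=> Alim; have mA := indicator_limit_measurable Alim.
  have [f [fc f01 fA]] := Alim.
  have cvg_nu (nu : signed T R) :
      cintegral nu (f n) @[n --> \oo] --> nu A.
    set D := svalP (cid (hahn_exists nu)).
    have -> : nu A = (fine (jordan_pos D A) - fine (jordan_neg D A))%:E.
      have fE (m : {finite_measure set (borel T) -> \bar R}) : (fine (m A))%:E = m A.
        by rewrite fineK// fin_num_measure.
      have := jordan_decomp D mA; rewrite /cadd /= /cscale EFinN mulN1e => ->.
      by rewrite EFinB !fE.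
    rewrite (_ : (fun n => _) = (fun n => (\int[jordan_pos D]_x f n x -
        \int[jordan_neg D]_x f n x)%:E)); last first.
      apply/funext => n; rewrite /cintegral -/D !bounded_EFin_Rintegral//;
      by [exact: continuous_measurable|exact: unit_bounded].
    apply: cvg_EFin; first exact: nearW.
    by apply: cvgB; exact: indicator_limit_Rintegral.
  apply: cvg_unique (cvg_nu nu1) _ => //.
  rewrite (_ : (fun n => _) = (fun n => cintegral nu2 (f n))); first exact: cvg_nu.
  by apply/funext => n; apply: nu12; split => //; exact: unit_bounded.
move=> A; rewrite {1}gen.
apply: (@dynkin_induction _ (borel T) (@indicator_limit R T)
  [set A | nu1 A = nu2 A]) => //=.
- exact: indicator_limitI.
- by apply: key; exact: indicator_limitT.
- move=> S mS nuS; rewrite -setTD !chargeD// !setTI nuS.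
  by rewrite key//; exact: indicator_limitT.
- move=> F mF tF nuF.
  have mUF := bigcup_measurable (fun i (_ : setT i) => mF i).
  have h1 := @charge_semi_sigma_additive _ _ _ nu1 F mF tF mUF.
  have h2 := @charge_semi_sigma_additive _ _ _ nu2 F mF tF mUF.
  apply: cvg_unique h1 _ => //.
  rewrite (_ : (fun n => _) = (fun n => \sum_(0 <= i < n) nu2 (F i))%E)//.
  by apply/funext => n; apply: eq_bigr => i _; exact: nuF.
Qed.

(** For an indicator limit A, l(A) is the pointwise limit of the integrals of continuous
    approximants against l, which are narrowly continuous in l. The sets with measurable evaluation
    form a Dynkin system. *)
Lemma measurable_eval (X : polishType R) (A : set (borel X)) :
  measurable A ->
  measurable_fun [set: borel (narrow R X)] (fun l : Pr X R => l A).
Proof.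
rewrite borel_polish.
apply: (@dynkin_induction _ (borel X) (@indicator_limit R X)
  [set A | measurable_fun [set: borel (narrow R X)] (fun l : Pr X R => l A)]).
- exact: borel_polish.
- exact: indicator_limitI.
- by rewrite /= (_ : (fun _ => _) = cst 1%E)//; apply/funext => l; exact: probability_setT.
- move=> B Blim /=; have mB := indicator_limit_measurable Blim.
  have [f [fc f01 fB]] := Blim.
  have bcf n : bounded_continuous (f n) by split => //; exact: unit_bounded.
  rewrite (_ : (fun _ => _) = EFin \o (fun l : Pr X R => fine (l B))); last first.
    by apply/funext => l /=; rewrite fineK// fin_num_measure.
  apply/measurable_EFinP.
  apply: (@measurable_fun_cvg _ (borel (narrow R X)) R setT
    (fun n (l : Pr X R) => \int[l]_x f n x)%R).
    move=> n; apply: (@continuous_measurable _ (narrow R X)) => l.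
    pose phi : {phi : X -> R | bounded_continuous phi} := exist _ (f n) (bcf n).
    pose S := prod_topology (fun _ : {phi : X -> R | bounded_continuous phi} => R).
    apply: (@continuous_comp (narrow R X) S R (@narrow_eval R X) (fun g => g phi)).
      exact: initial_continuous.
    exact: prod_eval_continuous.
  by move=> l _; exact: indicator_limit_Rintegral.
- move=> S mS /= mlS.
  rewrite (_ : (fun _ => _) = (fun l : Pr X R => 1 - l S)%E); last first.
    by apply/funext => l; rewrite probability_setC.
  exact: emeasurable_funB.
- move=> F mF tF /= mlF.
  rewrite (_ : (fun _ => _) = (fun l : Pr X R => \sum_(0 <= i <oo) l (F i))%E); last first.
    apply/funext => l; rewrite measure_semi_bigcup//; exact: bigcup_measurable.
  exact: ge0_emeasurable_sum.
Qed.

End borel_generation.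

(** * Mixtures of kernels *)

Section mixtures.
Context d (S : measurableType d) (R : realType).

Lemma integrable_combination (m : {finite_measure set S -> \bar R}) (I : finType)
    (c : I -> R) (g : I -> S -> R) :
  (forall i, m.-integrable [set: S] (EFin \o g i)) ->
  m.-integrable [set: S] (fun t => (\sum_i c i * g i t)%:E).
Proof.
move=> ig; rewrite (_ : (fun t => _) = fun t => (\sum_i (c i)%:E * (g i t)%:E)%E).
  apply: integrable_sum => // i _.
  exact: (@integrableZl _ _ _ _ _ measurableT (c i) _ (ig i)).
by apply/funext => t; rewrite -sumEFin.
Qed.

Lemma Rintegral_combination (m : {finite_measure set S -> \bar R}) (I : finType)
    (c : I -> R) (g : I -> S -> R) :
  (forall i, m.-integrable [set: S] (EFin \o g i)) ->
  (\int[m]_t (\sum_i c i * g i t)%:E = (\sum_i c i * \int[m]_t g i t)%:E)%E.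
Proof.
move=> ig.
rewrite (eq_integral (fun t => \sum_i (c i)%:E * (g i t)%:E)%E); last first.
  by move=> t _; rewrite -sumEFin.
rewrite integral_sum//; last first.
  by move=> i; exact: (@integrableZl _ _ _ _ _ measurableT (c i) _ (ig i)).
rewrite -sumEFin; apply: eq_bigr => i _.
rewrite (integralZl measurableT (ig i)) EFinM /Rintegral fineK//.
exact: (integrable_fin_num measurableT (ig i)).
Qed.

Lemma Rintegral_bounded d' (U : measurableType d')
    (m : subprobability U R) (f : U -> R) (M : R) :
  measurable_fun [set: U] f -> (forall x, `|f x| <= M) -> `|\int[m]_x f x| <= M.
Proof.
move=> mf fM; have M0 : 0 <= M by rewrite (le_trans (normr_ge0 (f point))).
have bf : [bounded f x | x in [set: U]].
  exact: bounded_le fM.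
rewrite (le_trans (le_normr_Rintegral _ (bounded_integrable m mf bf)))//.
rewrite -lee_fin -bounded_EFin_Rintegral//; last 2 first.
  exact: measurableT_comp.
  by apply: (@bounded_le _ _ _ M) => x; rewrite normr_id.
apply: (@le_trans _ _ (M%:E * m [set: U])%E).
  apply: (@integral_le_bound _ _ _ m setT (EFin \o f) M%:E) => //.
    exact/measurable_EFinP.
  by apply: aeW => x _; rewrite /= lee_fin.
by rewrite -[leRHS]mule1 lee_wpmul2l ?lee_fin// sprobability_setT.
Qed.

Section bind.
Context d' (U : measurableType d').
Variables (alpha : giry S R) (Q : S -> giry U R).
Hypothesis mQ : measurable_fun [set: S] Q.

Lemma giry_bindE (A : set U) : measurable A ->
  giry_bind alpha mQ A = (\int[alpha]_t Q t A)%E.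
Proof.
move=> mA; have := @giry_int_map _ _ _ _ R _ mQ alpha (giry_ev ^~ A); apply.
  exact: measurable_giry_ev.
by move=> x; exact: measure_ge0.
Qed.

Lemma measurable_giry_fun (A : set U) : measurable A ->
  measurable_fun [set: S] (fun t => Q t A).
Proof.
move=> mA; apply: (@measurableT_comp _ _ _ _ _ _ (giry_ev ^~ A) _ Q) => //.
exact: measurable_giry_ev.
Qed.

Lemma measurable_Rintegral (f : U -> R) :
  measurable_fun [set: U] f -> [bounded f x | x in [set: U]] ->
  measurable_fun [set: S] (fun t => \int[Q t]_x f x).
Proof.
move=> mf bf; apply/measurable_EFinP.
rewrite (_ : EFin \o _ = fun t => (\int[Q t]_x (EFin \o f)^\+ x - \int[Q t]_x (EFin \o f)^\- x)%E).
  apply: emeasurable_funB;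
  apply: (@measurableT_comp _ _ _ _ _ _ (fun m : giry U R => giry_int m _) _ Q) => //;
  apply: measurable_giry_int => //.
  - by apply: measurable_funepos; exact/measurable_EFinP.
  - by apply: measurable_funeneg; exact/measurable_EFinP.
by apply/funext => t /=; rewrite -bounded_EFin_Rintegral// integralE.
Qed.

(** The identity for nonnegative functions extends to bounded ones by adding a constant M. *)
Lemma Rintegral_bind (f : U -> R) :
  measurable_fun [set: U] f -> [bounded f x | x in [set: U]] ->
  \int[giry_bind alpha mQ]_x f x = \int[alpha]_t \int[Q t]_x f x.
Proof.
move=> mf bf; have [M0 [_ M0f]] := bf; pose M := `|M0| + 1.
have fM x : `|f x| <= M by apply: M0f => //; rewrite /M ltr_pwDr// ler_norm.
have [fM0 M0'] : (forall x, 0 <= f x + M) /\ 0 <= M.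
  split=> [x|]; first by have := fM x; rewrite ler_norml; lra.
  by rewrite (le_trans (normr_ge0 (f point))).
have key (g : U -> R) : (forall x, 0 <= g x) -> measurable_fun [set: U] g ->
    [bounded g x | x in [set: U]] ->
    \int[giry_bind alpha mQ]_x g x = \int[alpha]_t \int[Q t]_x g x.
  move=> g0 mg bg; rewrite /Rintegral; congr fine.
  have := @giry_int_bind _ _ _ _ R alpha Q mQ (fun x => (g x)%:E).
  rewrite /giry_int => ->//; last exact/measurable_EFinP.
  by apply: eq_integral => t _; exact: bounded_EFin_Rintegral.
have bfM : [bounded f x + M | x in [set: U]].
  apply: (@bounded_le _ _ _ (M + M)) => x; rewrite (le_trans (ler_normD _ _))//.
  by rewrite lerD// ger0_norm.
have bM : [bounded (fun=> M : R) x | x in [set: U]].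
  exact: (@bounded_le _ _ _ `|M|).
have mfM : measurable_fun [set: U] (fun x => f x + M) by apply: measurable_funD.
(* The total mass of [m] may be less than 1, so the integral of the constant M is subtracted and not
   M itself. *)
have fE (m : giry U R) : \int[m]_x f x = \int[m]_x (f x + M) - \int[m]_x (fun=> M) x.
  rewrite -RintegralB//; [|exact: bounded_integrable..].
  by apply: eq_Rintegral => x _; rewrite addrK.
rewrite fE !key// -RintegralB//; first by apply: eq_Rintegral => t _; rewrite -fE.
- apply: bounded_integrable; first exact: measurable_Rintegral.
  apply: (@bounded_le _ _ _ (M + M)) => t; apply: Rintegral_bounded => // x.
  by rewrite (le_trans (ler_normD _ _))// lerD// ger0_norm.
- apply: bounded_integrable; first exact: measurable_Rintegral.
  apply: (@bounded_le _ _ _ M) => t; apply: Rintegral_bounded => // x.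
  by rewrite ger0_norm.
Qed.

End bind.

End mixtures.

Section combinations.
Context d (S : measurableType d) (R : realType).

(* Fixing one combination of positive kernels for all parameters avoids having
   to choose Jordan decompositions measurably in the parameter. *)
Definition kernel_combination (U : ptopologicalType) (K : S -> signed U R) : Prop :=
  exists (I : finType) (c : I -> R) (Q : I -> S -> giry (borel U) R),
    (forall i, measurable_fun [set: S] (Q i)) /\
    (forall t A, measurable A -> K t A = \sum_i (c i)%:E * Q i t A)%E.

Lemma kernel_combination_of_prob (U : ptopologicalType) (Q : S -> Pr U R) :
  (forall A, measurable A -> measurable_fun [set: S] (fun t => Q t A)) ->
  kernel_combination (fun t => of_prob (Q t)).
Proof.
move=> mQ; exists unit, (fun=> 1), (fun _ t => Q t : giry _ _); split=> [_|t A mA].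
  by apply: measurable_giry_codensity.
by rewrite big_const card_unit /= adde0 mul1e.
Qed.

Lemma kernel_combination0 (U : ptopologicalType) :
  kernel_combination (fun=> zerom : signed U R).
Proof.
exists void, (fun=> 0), (fun i : void => match i with end); split=> [[]|t A mA].
by rewrite big1// => -[].
Qed.

Lemma kernel_combination_add (U : ptopologicalType) (K1 K2 : S -> signed U R) :
  kernel_combination K1 -> kernel_combination K2 ->
  kernel_combination (fun t => addm (K1 t) (K2 t)).
Proof.
move=> [I1 [c1 [Q1 [mQ1 K1E]]]] [I2 [c2 [Q2 [mQ2 K2E]]]].
exists (I1 + I2)%type,
  (fun i => match i with inl i => c1 i | inr i => c2 i end),
  (fun i => match i with inl i => Q1 i | inr i => Q2 i end).
split=> [[]//|t A mA]; rewrite big_sumType/= -K1E// -K2E//.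
Qed.

Lemma kernel_combination_scale (U : ptopologicalType) (a : R) (K : S -> signed U R) :
  kernel_combination K -> kernel_combination (fun t => scalem a (K t)).
Proof.
move=> [I [c [Q [mQ KE]]]]; exists I, (fun i => a * c i), Q; split=> // t A mA.
rewrite /scalem /= /cscale KE// fin_num_sume_distrr//; last first.
  by move=> i j _ _; rewrite fin_num_adde_defl// fin_numM// fin_num_measure.
by apply: eq_bigr => i _; rewrite EFinM muleA.
Qed.

Lemma kernel_combination_sum (U : ptopologicalType) (J : Type) (r : seq J)
    (K : J -> S -> signed U R) : (forall j, kernel_combination (K j)) ->
  kernel_combination (fun t => \big[@addm R U/zerom]_(j <- r) K j t).
Proof.
move=> cK; elim: r => [|j r IH].
  rewrite (_ : (fun=> _) = fun=> zerom); first exact: kernel_combination0.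
  by apply/funext => t; rewrite big_nil.
rewrite (_ : (fun=> _) = fun t => addm (K j t) (\big[@addm R U/zerom]_(j <- r) K j t)).
  exact: kernel_combination_add.
by apply/funext => t; rewrite big_cons.
Qed.

Lemma kernel_combination_push (U V : ptopologicalType) (K : S -> signed U R)
    (f : {mfun borel U >-> borel V}) :
  kernel_combination K -> kernel_combination (fun t => pushm (K t) f).
Proof.
have mf : measurable_fun setT f by exact: measurable_funPT.
move=> [I [c [Q [mQ KE]]]]; exists I, c, (fun i t => giry_map mf (Q i t)).
split=> [i|t A mA]; first by apply: measurableT_comp => //; exact: measurable_giry_map.
rewrite /pushm /= /push_charge /pushforward KE// -[X in measurable X]setTI.
exact: mf.
Qed.

(** The kernels are integrated against [alpha] one by one and recombined with the same coefficients.
    The formula on sets serves the total variation bound, the one on functions the comparison with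
    [is_integral]. *)
Lemma mixture_exists (U : ptopologicalType) (alpha : giry S R)
    (K : S -> signed U R) : kernel_combination K ->
  exists nu : signed U R,
    (forall A, measurable A ->
      alpha.-integrable [set: S] (fun t => K t A) /\
      nu A = \int[alpha]_t K t A)%E /\
    (forall phi : U -> R, measurable_fun [set: borel U] phi ->
      [bounded phi x | x in [set: U]] ->
      alpha.-integrable [set: S] (fun t => cintegral (K t) phi) /\
      cintegral nu phi = \int[alpha]_t cintegral (K t) phi)%E.
Proof.
move=> [I [c [Q [mQ KE]]]].
pose M i := giry_bind alpha (mQ i).
pose nu : signed U R := \big[@addm R U/zerom]_i scalem (c i) (charge_of_finite_measure (M i)).
have nuE A : measurable A -> (nu A = \sum_i (c i)%:E * M i A)%E.
  move=> mA; rewrite /nu; elim: (index_enum I) => [|i s IH].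
    by rewrite !big_nil.
  by rewrite !big_cons -IH.
exists nu; split=> [A mA|phi mphi bphi].
- have mQA i : measurable_fun [set: S] (fun t => fine (Q i t A)).
    by apply: measurableT_comp => //; exact: measurable_giry_fun.
  have fQ i t : (fine (Q i t A))%:E = Q i t A by rewrite fineK// fin_num_measure.
  have iQ i : alpha.-integrable [set: S] (EFin \o (fun t => fine (Q i t A))).
    apply: bounded_integrable => //.
    apply: (@bounded_le _ _ _ 1) => t; rewrite ger0_norm ?fine_ge0//.
    rewrite -lee_fin fQ (le_trans _ (@sprobability_setT _ _ _ (Q i t)))//.
    by rewrite le_measure// inE.
  rewrite nuE// (_ : (fun t => K t A) = fun t => (\sum_i c i * fine (Q i t A))%:E).
    split; first exact: integrable_combination.
    rewrite Rintegral_combination// -sumEFin; apply: eq_bigr => i _.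
    rewrite EFinM /M giry_bindE// /Rintegral; congr (_ * _)%E.
    under [in RHS]eq_integral do rewrite fQ.
    by rewrite fineK// -giry_bindE// fin_num_measure.
  by apply/funext => t; rewrite KE// -sumEFin; apply: eq_bigr => i _; rewrite EFinM fQ.
- have iQ i : alpha.-integrable [set: S] (EFin \o (fun t => \int[Q i t]_x phi x)).
    apply: bounded_integrable; first exact: measurable_Rintegral.
    have [M0 [_ M0f]] := bphi.
    apply: (@bounded_le _ _ _ (`|M0| + 1)) => t; apply: Rintegral_bounded => // x.
    by apply: M0f => //; rewrite ltr_pwDr// ler_norm.
  rewrite (cintegral_combination nuE)//.
  rewrite (_ : (fun t => _) = fun t => (\sum_i c i * \int[Q i t]_x phi x)%:E).
    split; first exact: integrable_combination.
    rewrite Rintegral_combination//.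
    by congr EFin; apply: eq_bigr => i _; rewrite Rintegral_bind.
  by apply/funext => t; rewrite (cintegral_combination (KE t)).
Qed.

End combinations.

(** * The expansions as combinations of kernels on the space of measures *)

Section expansion_kernels.
Variables (R : realType) (X : polishType R).

Definition measurable_family d (S : measurableType d) (U : ptopologicalType)
    (Q : S -> Pr U R) : Prop :=
  forall A, measurable A -> measurable_fun [set: S] (fun t => Q t A).

Lemma measurable_family_distribution d (S : measurableType d)
    (U V : ptopologicalType) (Q : S -> Pr U R) (f : {mfun borel U >-> borel V}) :
  measurable_family Q -> measurable_family (fun t => distribution (Q t) f : Pr V R).
Proof.
move=> mQ A mA; apply: mQ; rewrite -[X in measurable X]setTI.
exact: measurable_funPT.
Qed.

(** The product of measures is a measurable map between Giry spaces; it is composed with evaluation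
    at the preimage of A under concatenation. *)
Lemma measurable_family_tensor d (S : measurableType d) a b
    (Q1 : S -> Pr (Xpow X a) R) (Q2 : S -> Pr (Xpow X b) R) :
  measurable_family Q1 -> measurable_family Q2 ->
  measurable_family (fun t => tensor (Q1 t) (Q2 t)).
Proof.
move=> mQ1 mQ2 A mA.
have mQ : measurable_fun [set: S]
    (fun t => (Q1 t : giry _ R, Q2 t : giry _ R)).
  by apply: measurable_fun_pair; apply: measurable_giry_codensity.
have mcA : measurable (catm X a b @^-1` A).
  by rewrite -[X in measurable X]setTI; exact: measurable_funPT.
apply: (@measurableT_comp _ _ _ _ _ _ (giry_ev ^~ (catm X a b @^-1` A)) _
  (fun t => giry_prod (Q1 t : giry _ R, Q2 t : giry _ R))).
  exact: measurable_giry_ev.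
by apply: measurableT_comp mQ; exact: measurable_giry_prod.
Qed.

(** The parameter space of the kernels; the number of points is written [n] in this section. *)
Let N := borel (narrow R X).

Lemma measurable_family_diag_push m :
  measurable_family (fun l : N => @diag_push R X m l).
Proof. by apply: measurable_family_distribution; exact: measurable_eval. Qed.

Lemma measurable_family_unit_pow : measurable_family (fun _ : N => @unit_pow R X).
Proof. by move=> A mA; exact: measurable_cst. Qed.

Lemma measurable_family_power m : measurable_family (fun l : N => @power R X l m).
Proof.
elim: m => [|m IH]; first exact: measurable_family_unit_pow.
exact: (measurable_family_tensor (@measurable_family_diag_push 1) IH).
Qed.

Lemma measurable_family_diag_blocks s :
  measurable_family (fun l : N => @diag_blocks R X l s).
Proof.
elim: s => [|m s IH]; first exact: measurable_family_unit_pow.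
exact: (measurable_family_tensor (@measurable_family_diag_push m) IH).
Qed.

Lemma measurable_family_P_term k j (p : kpartition k j) :
  measurable_family (fun l : N => @P_term R X k j l p).
Proof.
apply: measurable_family_distribution; apply: measurable_family_tensor.
  exact: measurable_family_diag_blocks.
exact: measurable_family_power.
Qed.

Lemma kernel_combination_symm d (S : measurableType d) k
    (K : S -> signed (Xpow X k) R) :
  kernel_combination K -> kernel_combination (fun t => symm (K t)).
Proof.
move=> cK; apply: kernel_combination_scale; apply: kernel_combination_sum => s.
exact: kernel_combination_push.
Qed.

Lemma kernel_combination_P_poly k j :
  kernel_combination (fun l : N => @P_poly R X k j l).
Proof.
apply: kernel_combination_sum => p; apply: kernel_combination_scale.
by apply: kernel_combination_of_prob; exact: measurable_family_P_term.
Qed.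

Lemma kernel_combination_F_trunc n k p :
  kernel_combination (fun l : N => @F_trunc R X n k p l).
Proof.
apply: kernel_combination_scale; apply: kernel_combination_add.
  by apply: kernel_combination_of_prob; exact: measurable_family_power.
apply: kernel_combination_sum => j; apply: kernel_combination_scale.
exact: kernel_combination_symm (kernel_combination_P_poly _ _).
Qed.

End expansion_kernels.

(** * Empirical measures form a Borel set *)

Section point_masses.
Variables (R : realType) (T : Type).

(** An unnormalised empirical measure, repeated points counting with multiplicity. *)
Definition point_masses (xs : seq T) (A : set T) : R := \sum_(x <- xs) \1_A x.

Lemma point_masses_count xs A :
  point_masses xs A = (count (fun x => x \in A) xs)%:R.
Proof.
rewrite /point_masses; elim: xs => [|x xs IH]; first by rewrite big_nil.
by rewrite big_cons IH /= natrD indicE.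
Qed.

Lemma point_masses_setID xs A B :
  point_masses xs A = point_masses xs (A `&` B) + point_masses xs (A `\` B).
Proof.
rewrite /point_masses -big_split; apply: eq_bigr => x _ /=.
by rewrite !indicE in_setI in_setD; case: (x \in A); case: (x \in B) => /=; rewrite ?addr0 ?add0r.
Qed.

Lemma point_masses_cvg xs (C : (set T)^nat) : nonincreasing_seq C ->
  point_masses xs (C n) @[n --> \oo] --> point_masses xs (\bigcap_n C n).
Proof.
move=> ndC; rewrite /point_masses; elim: xs => [|x xs IH].
  rewrite big_nil (_ : (fun n => _) = fun=> 0); first exact: cvg_cst.
  by apply/funext => n; rewrite big_nil.
rewrite big_cons (_ : (fun n => _) = fun n => \1_(C n) x + \sum_(x <- xs) \1_(C n) x).
  apply: cvgD => //; have [Cx|/existsNP[n0 /not_implyP[_ nCx]]] := pselect ((\bigcap_n C n) x).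
    rewrite [in X in _ --> X]indicE mem_set//= (_ : (fun n => _) = fun=> 1).
      exact: cvg_cst.
    by apply/funext => n; rewrite indicE mem_set//; exact: Cx.
  rewrite [in X in _ --> X]indicE memNset/=; last by move=> /(_ n0 I).
  apply: cvg_near_cst; exists n0 => // n /= n0n; apply/eqP.
  rewrite indicE memNset// => Cnx; apply: nCx.
  by have /subsetPset := ndC _ _ n0n; exact.
by apply/funext => n; rewrite big_cons.
Qed.

End point_masses.

Section empirical_measures.
Variables (R : realType) (X : polishType R).
Implicit Types (l : Pr X R) (A : set (borel X)).

Lemma separating_sequence : exists C : nat -> set X,
  [/\ forall n, open (C n),
    (forall x A, nbhs x A -> exists2 n, C n x & C n `<=` A) &
    forall x y, x <> y -> exists n, C n x /\ ~ C n y].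
Proof.
have [B [oB Bx]] := polish_countable_basis X.
(* The basis is renumbered by the naturals; numbers that encode no pair get the whole space. *)
pose C (n : nat) := if unpickle n is Some q then B q else setT.
have basis x A : nbhs x A -> exists2 n, C n x & C n `<=` A.
  by move=> /Bx[q Bqx BqA]; exists (pickle q); rewrite /C pickleK.
exists C; split => // [n|x y xy].
  by rewrite /C; case: unpickle => [q|]; [exact: oB|exact: openT].
have [d [dE dC dT nbhsd _]] := (@polishP R X).2.
have dxy : 0 < d x y.
  rewrite lt_neqAle (proj1 (dE x y)) andbT eq_sym; apply/eqP.
  by move=> /(proj2 (dE x y)).
have : nbhs x [set z | d x z < d x y] by apply/nbhsd; exists (d x y).
by move=> /basis[n Cx CA]; exists n; split=> // /CA /=; rewrite ltxx.
Qed.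

Section atoms.
Variables (l : Pr X R) (N : nat).
Hypothesis l_nat : forall A, measurable A -> exists m : nat, N%:R * fine (l A) = m%:R.

Let nl A := N%:R * fine (l A).

Let nl_setID A B : measurable A -> measurable B ->
  nl A = nl (A `&` B) + nl (A `\` B).
Proof.
move=> mA mB; rewrite /nl -mulrDr -fineD.
- by rewrite [in LHS](measureDI l mA mB) addeC.
- by apply: fin_num_measure; exact: measurableI.
- by apply: fin_num_measure; exact: measurableD.
Qed.

(** With fewer than N points removed, the remainder r of N l still has positive total mass. It takes
    integer values, so positive mass on a set means mass at least 1. *)
Lemma exists_atom (xs : seq (borel X)) : (size xs < N)%N ->
  (forall A, measurable A -> point_masses R xs A <= N%:R * fine (l A)) ->
  exists x : borel X, forall A, measurable A ->
    point_masses R (x :: xs) A <= N%:R * fine (l A).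
Proof.
move=> xsN xsl; pose r A := nl A - point_masses R xs A.
have r_ge0 A : measurable A -> 0 <= r A by move=> /xsl; rewrite subr_ge0.
have r_setID A B : measurable A -> measurable B ->
    r A = r (A `&` B) + r (A `\` B).
  move=> mA mB; rewrite /r (nl_setID mA mB) (point_masses_setID _ xs A B); lra.
have r_ge1 A : measurable A -> 0 < r A -> 1 <= r A.
  move=> mA; rewrite /r /nl; have [m ->] := l_nat mA; rewrite point_masses_count.
  by rewrite subr_gt0 ltr_nat lerBrDr addrC natr1 ler_nat.
have [D [oD _ Dsep]] := separating_sequence.
have mD n : measurable (D n : set (borel X)) by apply: sub_sigma_algebra; exact: oD.
(* A nested sequence of cells, each carrying mass for the remaining measure r;
   since r is integer valued, the mass survives in the limit, which is a point. *)
pose step C B : set (borel X) := if 1 <= r (C `&` B) then C `&` B else C `\` B.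
pose C := fix C n := if n is n'.+1 then step (C n') (D n') else [set: borel X].
have Cr n : measurable (C n) /\ 1 <= r (C n).
  elim: n => [|n [mC rC]] /=.
    split=> //; apply: r_ge1 => //; rewrite /r /nl probability_setT mulr1.
    rewrite point_masses_count subr_gt0 ltr_nat (leq_ltn_trans _ xsN)//.
    exact: count_size.
  rewrite /step; case: ifPn => [h|]; first by split=> //; exact: measurableI.
  rewrite -ltNge => h; have mCD := measurableD mC (mD n).
  split=> //; apply: r_ge1 => //; have := r_setID _ _ mC (mD n); lra.
have mC n := (Cr n).1.
have mCoo : measurable (\bigcap_n C n) by exact: bigcapT_measurable.
have ndC : nonincreasing_seq C.
  apply/nonincreasing_seqP => n; apply/subsetPset => /=.
  by rewrite /step; case: ifP => _; exact: subIsetl.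
have rCoo : 1 <= r (\bigcap_n C n).
  have rcvg : r (C n) @[n --> \oo] --> r (\bigcap_n C n).
    apply: cvgB; last exact: point_masses_cvg.
    apply: cvgMr; apply: fine_cvg; rewrite fineK ?fin_num_measure//.
    apply: nonincreasing_cvg_mu => //.
    by rewrite ltey_eq fin_num_measure.
  rewrite -(cvg_lim _ rcvg)//; apply: limr_ge; first by apply/cvg_ex; eexists; exact: rcvg.
  by apply: nearW => n; exact: (Cr n).2.
have [x Cx] : (\bigcap_n C n) !=set0.
  apply/set0P/negP => /eqP C0; move: rCoo; rewrite C0 /r /nl measure0 mulr0.
  rewrite point_masses_count (eq_count (a2 := pred0)); last by move=> y /=; rewrite in_set0.
  by rewrite count_pred0; lra.
(* Two distinct points are separated by some [D n], but [C n.+1] lies on one side of [D n]. *)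
have Cx1 : \bigcap_n C n `<=` [set x].
  move=> y Cy; apply: contrapT => /eqP; rewrite eq_sym => /eqP /Dsep[n [Dx nDy]].
  have /= := Cy n.+1 I; have /= := Cx n.+1 I.
  by rewrite /step; case: ifP => _ [_ +] [_ +].
exists x => A mA; rewrite /point_masses big_cons -/(point_masses R xs A).
rewrite indicE; have [Ax|nAx] := boolP (x \in A); last by rewrite add0r xsl.
(* If A contains x, it contains the limit cell, so r(A) is at least 1 and one more point mass
   fits. *)
rewrite -lerBrDr -/(nl A) -/(r A) (r_setID _ _ mA mCoo).
rewrite (_ : A `&` _ = \bigcap_n C n); last first.
  by apply/setIidr => y /Cx1 ->; exact: set_mem.
by rewrite ler_wpDr// r_ge0//; exact: measurableD.
Qed.

Lemma exists_atoms m : (m <= N)%N -> exists xs : seq (borel X), size xs = m /\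
  forall A, measurable A -> point_masses R xs A <= N%:R * fine (l A).
Proof.
elim: m => [_|m IH mN].
  exists [::]; split=> // A mA.
  by rewrite /point_masses big_nil mulr_ge0// fine_ge0.
have [xs [sxs xsl]] := IH (ltnW mN).
have [|x xl] := @exists_atom xs _ xsl; first by rewrite sxs.
by exists (x :: xs); rewrite /= sxs.
Qed.

(** The N point masses lie below N l and have the same total mass N, so the inequality on the
    complement gives the reverse one. *)
Lemma integral_multiples_empirical : (0 < N)%N -> @empirical R X N l.
Proof.
move=> N0; have N0' : N%:R != 0 :> R by rewrite pnatr_eq0 -lt0n.
have [xs [sxs xsl]] := exists_atoms (leqnn N).
have lE A : measurable A -> N%:R * fine (l A) = point_masses R xs A.
  move=> mA; apply/eqP; rewrite eq_le xsl// andbT.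
  have := xsl _ (measurableC mA).
  have := nl_setID measurableT mA; have := point_masses_setID R xs setT A.
  rewrite /nl !setTI !setTD probability_setT /= mulr1 !point_masses_count.
  rewrite (eq_count (a2 := predT)) => [|y]; last by rewrite /= in_setT.
  rewrite count_predT sxs; lra.
exists (fun i => nth point xs i) => A mA.
have -> : l A = (N%:R^-1 * (N%:R * fine (l A)))%:E.
  by rewrite mulrA mulVf// mul1r fineK// fin_num_measure.
rewrite lE// EFinM; congr (_ * _)%E.
rewrite /point_masses (big_nth point) sxs big_mkord -sumEFin.
by apply: eq_bigr => i _; rewrite diracE indicE.
Qed.

End atoms.

Lemma measurable_empirical N : (0 < N)%N ->
  measurable (@empirical R X N : set (borel (narrow R X))).
Proof.
move=> N0; have N0' : N%:R != 0 :> R by rewrite pnatr_eq0 -lt0n.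
have [D [oD Dbasis _]] := separating_sequence.
have mD n : measurable (D n : set (borel X)) by apply: sub_sigma_algebra; exact: oD.
(* Finite intersections of basic sets: a countable family, closed under intersection by
   concatenating index lists. *)
pose box (s : seq nat) : set (borel X) := \big[setI/setT]_(n <- s) D n.
have mbox s : measurable (box s) by apply: bigsetI_measurable.
pose M : set \bar R := [set (m%:R / N%:R)%:E | m in `I_N.+1].
have finM : finite_set M by apply: finite_image; exact: finite_II.
have mM : measurable M.
  rewrite /M -bigcup_imset1; apply: fin_bigcup_measurable => [|m _]; first exact: finite_II.
  exact: emeasurable_set1.
(* The bound m <= N is automatic, since l(A) is at most 1. *)
have Mmeas l A (m : nat) : measurable A -> l A = (m%:R / N%:R)%:E -> M (l A).
  move=> mA lA; exists m => //=; rewrite ltnS -(ler_nat R).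
  have := probability_le1 l mA; rewrite lA lee_fin ler_pdivrMr ?mul1r//.
  by rewrite ltr0n.
suff -> : @empirical R X N = \bigcap_(s in [set: seq nat]) [set l : Pr X R | M (l (box s))].
  rewrite -[X in measurable X]setCK setC_bigcap; apply: measurableC.
  apply: countable_bigcupT_measurable => [|s]; first exact: countableP.
  apply: measurableC; rewrite -[X in measurable X]setTI.
  exact: (measurable_eval (mbox s)).
apply/seteqP; split=> [l [x lx] s _|l lM].
  apply: (Mmeas _ _ (count (fun i => x i \in box s) (index_enum 'I_N))) => //.
  rewrite lx// mulrC EFinM; congr (_ * _)%E.
  elim: (index_enum _) => [|i t IH]; first by rewrite big_nil.
  by rewrite big_cons IH /= natrD EFinD diracE.
apply: integral_multiples_empirical => // A mA.
suff [m _ lA] : M (l A) by exists m; rewrite -lA /= mulrCA divff ?mulr1.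
pose G := range box.
have GE : (measurable : set (set (borel X))) = <<s G >>.
  apply/seteqP; split; apply: smallest_sub.
  - exact: smallest_sigma_algebra.
  - move=> V oV; have -> : V = \bigcup_(n in [set n | D n `<=` V]) D n.
      apply/seteqP; split=> [y Vy|y [n nV]]; last exact: nV.
      by have [n Dny nV] := Dbasis y V (open_nbhs_nbhs (conj oV Vy)); exists n.
    rewrite bigcup_mkcond; apply: sigma_algebra_bigcup => n.
    case: ifPn => _; last exact: sigma_algebra0.
    by apply: sub_sigma_algebra; exists [:: n] => //; rewrite /box big_seq1.
  - exact: (@sigma_algebra_measurable _ (borel X)).
  - by move=> _ [s _ <-]; exact: mbox.
have MU (m1 m2 : nat) : (m1%:R / N%:R + m2%:R / N%:R = (m1 + m2)%:R / N%:R :> R)%R.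
  by rewrite -mulrDl natrD.
move: mA; rewrite GE.
apply: (@dynkin_induction _ (borel X) G [set A | M (l A)]) => //=.
- move=> _ _ [s _ <-] [t _ <-]; exists (s ++ t) => //.
  by rewrite /box big_cat.
- by rewrite probability_setT; exists N; [exact: ltnSn|rewrite divff].
- by move=> _ [s _ <-]; exact: lM.
- move=> S mS [m /= mN lS]; rewrite probability_setC// -lS.
  exists (N - m)%N => /=; first by rewrite ltnS leq_subr.
  by rewrite natrB// mulrBl divff// EFinB.
- move=> F mF tF MF.
  have mUF := bigcup_measurable (fun i (_ : setT i) => mF i).
  (* [M] is finite, hence closed, so the limit of the partial sums stays in it. Each partial sum is
     a multiple of 1/N and the measure of a finite union, so [Mmeas] applies. *)
  apply: (@closed_cvg _ _ _ _ (fun n => \sum_(0 <= i < n) l (F i))%E M)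
    (measure_semi_sigma_additive F mF tF mUF).
    have /accessible_finite_set_closed : accessible_space (\bar R).
      by apply: hausdorff_accessible; exact: ereal_hausdorff.
    exact.
  apply: nearW => n.
  have sumE : (\sum_(0 <= i < n) l (F i) = l (\big[setU/set0]_(i < n) F i))%E.
    by rewrite big_mkord measure_bigsetU.
  have [m lU] : exists m : nat, (\sum_(0 <= i < n) l (F i))%E = (m%:R / N%:R)%:E.
    elim: (n) => [|n' [m IH]]; first by exists 0%N; rewrite big_geq// mul0r.
    have [m' _ lF] := MF n'; exists (m + m')%N.
    by rewrite big_nat_recr//= IH -lF -EFinD MU.
  rewrite sumE; apply: (Mmeas _ _ m); last by rewrite -sumE.
  exact: bigsetU_measurable.
Qed.

End empirical_measures.

(** * The remainder of the expansion *)

Section remainder.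
Variable R : realType.

Lemma scalemE (U : ptopologicalType) (a : R) (nu : signed U R) A :
  scalem a nu A = (a%:E * nu A)%E.
Proof. by []. Qed.

Lemma addmE (U : ptopologicalType) (mu nu : signed U R) A :
  addm mu nu A = (mu A + nu A)%E.
Proof. by []. Qed.

Lemma sum_chargeE (U : ptopologicalType) (J : Type) (r : seq J) (K : J -> signed U R) A :
  (\big[@addm R U/zerom]_(j <- r) K j) A = (\sum_(j <- r) K j A)%E.
Proof.
by elim: r => [|j r IH]; [rewrite !big_nil|rewrite !big_cons -IH].
Qed.

Lemma abse_sum_le (J : Type) (r : seq J) (f : J -> \bar R) (b : J -> R) :
  (forall j, `|f j| <= (b j)%:E)%E -> (`|\sum_(j <- r) f j| <= (\sum_(j <- r) b j)%:E)%E.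
Proof.
move=> fb; elim: r => [|j r IH]; first by rewrite !big_nil abse0.
by rewrite !big_cons (le_trans (lee_abs_add _ _))// EFinD leeD.
Qed.

(** Bounds [P_poly k j l] on measurable sets uniformly in l, its terms being probability measures
    with nonnegative coefficients. *)
Definition partition_mass k j : R := \sum_(p : kpartition k j) d_coef R k j (parts p).

Lemma d_coef_ge0 k j p : 0 <= d_coef R k j p.
Proof.
by rewrite /d_coef !mulr_ge0 ?prodr_ge0 ?invr_ge0// => *; rewrite ?invr_ge0.
Qed.

Lemma partition_mass_ge0 k j : 0 <= partition_mass k j.
Proof. by apply: sumr_ge0 => p _; exact: d_coef_ge0. Qed.

Lemma prefactor_bound k n : (2 <= k)%N -> (k <= n)%N ->
  0 <= (n%:R ^+ k.-1 / \prod_(1 <= i < k) (n%:R - i%:R) : R) <= k%:R ^+ k.-1.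
Proof.
move=> k2 kn.
have n_gt i : (1 <= i < k)%N -> 0 < n%:R - i%:R :> R.
  by move=> /andP[_ ik]; rewrite subr_gt0 ltr_nat (leq_trans ik).
have P0 : 0 < \prod_(1 <= i < k) (n%:R - i%:R) :> R.
  by rewrite big_nat; apply: prodr_gt0 => i; exact: n_gt.
apply/andP; split; first by rewrite divr_ge0 ?exprn_ge0// ltW.
rewrite ler_pdivrMr//.
have cst (a : R) : a ^+ k.-1 = \prod_(1 <= i < k) a by rewrite prodr_const_nat subn1.
rewrite !cst -big_split /= !big_nat; apply: ler_prod => i ik.
rewrite ler0n /=; move: (ik) => /andP[i1 ik'].
have ik1 : i%:R + 1 <= k%:R :> R by rewrite natr1 ler_nat.
have kn' : k%:R <= n%:R :> R by rewrite ler_nat.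
have k2' : 2 <= k%:R :> R by rewrite ler_nat.
(* As i <= k - 1, k (n - i) - n is at least (k - 1) (n - k) >= 0. *)
nra.
Qed.

Variable X : polishType R.
Implicit Types (l : Pr X R).

Lemma abse_P_poly k j l A : measurable A ->
  (`|@P_poly R X k j l A| <= (partition_mass k j)%:E)%E.
Proof.
move=> mA; rewrite /P_poly sum_chargeE; apply: abse_sum_le => p.
rewrite /scalem /= /cscale abseM gee0_abs ?lee_fin ?d_coef_ge0//.
rewrite -[leRHS]mule1 lee_wpmul2l ?lee_fin ?d_coef_ge0//.
rewrite -[of_prob _ A]/(P_term l p A) gee0_abs//.
exact: probability_le1.
Qed.

(** An average over the k! permutations keeps any bound that is uniform over measurable sets. *)
Lemma abse_symm k (nu : signed (Xpow X k) R) (b : R) A :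
  (forall B, measurable B -> `|nu B| <= b%:E)%E -> measurable A ->
  (`|symm nu A| <= b%:E)%E.
Proof.
move=> nub mA; rewrite /symm /scalem /= /cscale sum_chargeE abseM.
have f0 : (k`!%:R : R) != 0 by rewrite pnatr_eq0 -lt0n fact_gt0.
rewrite gee0_abs ?lee_fin ?invr_ge0//.
apply: (@le_trans _ _ ((k`!%:R^-1)%:E * (\sum_(s : 'S_k) b)%:E)%E).
  rewrite lee_wpmul2l ?lee_fin ?invr_ge0//; apply: abse_sum_le => s.
  apply: nub; rewrite -[X in measurable X]setTI; exact: measurable_funPT.
rewrite sumr_const card_Sn -EFinM -[b *+ _]mulr_natl mulrA mulVf// mul1r.
exact: lexx.
Qed.

Lemma F_trunc_remainder k n p l A : (2 <= k)%N -> (k <= n)%N -> (p < k)%N ->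
  measurable A ->
  (`|F_full n k l A - F_trunc n k p l A| <=
    (k%:R ^+ k.-1 * (\sum_(1 <= j < k) partition_mass k j) / n%:R ^+ p.+1)%:E)%E.
Proof.
move=> k2 kn pk mA.
have n0 : 0 < n%:R :> R by rewrite ltr0n (leq_trans _ kn)// (leq_trans _ k2).
have n1 : 1 <= n%:R :> R by rewrite ler1n (leq_trans _ kn)// (leq_trans _ k2).
set c : R := n%:R ^+ k.-1 / \prod_(1 <= i < k) (n%:R - i%:R).
(* All values are finite, so the difference is computed in the reals. *)
pose w := fine (of_prob (@power R X l k) A).
pose f j := fine (symm (@P_poly R X k j l) A).
have fE j : (f j)%:E = symm (@P_poly R X k j l) A by rewrite fineK// fin_num_measure.
have FE q : F_trunc n k q l A =
    (c * (w + \sum_(1 <= j < q.+1) (-1) ^+ j / n%:R ^+ j * f j))%:E.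
  rewrite /F_trunc scalemE addmE sum_chargeE -/c [RHS]EFinM [in RHS]EFinD; congr (_ * (_ + _))%E.
    by rewrite /w fineK// fin_num_measure.
  by rewrite -sumEFin; apply: eq_bigr => j _; rewrite scalemE [RHS]EFinM fE.
have fb j : `|f j| <= partition_mass k j.
  have := abse_symm (fun B mB => @abse_P_poly k j l B mB) mA.
  by rewrite -fE /= lee_fin.
rewrite /F_full !FE prednK ?(ltnW k2)// -EFinB -mulrBr /= lee_fin normrM.
have -> : w + \sum_(1 <= j < k) (-1) ^+ j / n%:R ^+ j * f j -
    (w + \sum_(1 <= j < p.+1) (-1) ^+ j / n%:R ^+ j * f j) =
    \sum_(p.+1 <= j < k) (-1) ^+ j / n%:R ^+ j * f j.
  by rewrite (@big_cat_nat _ _ _ p.+1 1 k)//=; ring.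
have /andP[c0 ck] : 0 <= c <= k%:R ^+ k.-1 by exact: prefactor_bound.
rewrite (ger0_norm c0) -mulrA; apply: ler_pM => //.
rewrite (le_trans (ler_norm_sum _ _ _))// mulr_suml.
(* Nonnegative terms with j <= p are added to make the constant independent of p; the terms left
   have n^-j <= n^-(p+1). *)
rewrite [leRHS](@big_cat_nat _ _ _ p.+1 1 k)//= ler_wpDl//.
  apply: sumr_ge0 => j _; apply: mulr_ge0; first exact: partition_mass_ge0.
  by rewrite invr_ge0 exprn_ge0.
rewrite !big_nat; apply: ler_sum => j /andP[pj _].
rewrite !normrM normrX normrN1 expr1n mul1r [leLHS]mulrC.
rewrite (@ger0_norm _ (_^-1)) ?invr_ge0 ?exprn_ge0//.
apply: ler_pM => //.
by rewrite lef_pV2 ?posrE ?exprn_gt0// ler_weXn2l.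
Qed.

End remainder.

(** * The total variation estimate for the mixtures *)

Theorem corollary6p2 (R : realType) (k : nat) (hk : (2 <= k)%N) :
  exists B : R, forall (X : polishType R) (N : nat) (hN : (k <= N)%N)
    (mu : Pr (Xpow X k) R) (alpha : Pr (narrow R X) R) (p : nat),
    N_representable hN mu ->
    alpha (@empirical R X N) = 1%E ->
    is_integral alpha (@empirical R X N) (F_full N k) (of_prob mu) ->
    (1 <= p)%N -> (p <= k - 2)%N ->
    exists2 nu : signed (Xpow X k) R,
      is_integral alpha [set: narrow R X] (F_trunc N k p) nu &
      (tv mu nu <= (B / N%:R ^+ p.+1)%:E)%E.
Proof.
(* The constant of [F_trunc_remainder]. *)
exists (k%:R ^+ k.-1 * \sum_(1 <= j < k) partition_mass R k j).
move=> X N hN mu alpha p _ alphaE muE p1 pk.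
have N0 : (0 < N)%N by rewrite (leq_trans _ hN)// (leq_trans _ hk).
have pltk : (p < k)%N.
  by rewrite (leq_ltn_trans pk)// ltn_subrL (leq_trans _ hk).
have [nu [nuE nuI]] :=
  mixture_exists (alpha : giry _ R) (@kernel_combination_F_trunc R X N k p).
(* The full expansion is the truncation at k - 1; its mixture will be identified with [mu]. *)
have [nu' [nu'E nu'I]] :=
  mixture_exists (alpha : giry _ R) (@kernel_combination_F_trunc R X N k k.-1).
exists nu; first by move=> phi [cphi bphi]; apply: (nuI phi _ bphi).2; exact: continuous_measurable.
have mE := @measurable_empirical R X N N0.
have munu' : ceq (of_prob mu) nu'.
  apply: charge_eq_of_cintegral; first exact: borel_Xpow.
  move=> phi bcphi; rewrite muE//; have [cphi bphi] := bcphi.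
  have [iF ->] := nu'I phi (continuous_measurable cphi) bphi.
  (* The complement of the empirical measures is Borel and null, so integrating over them or over
     all measures gives the same. *)
  have aC0 : alpha (~` @empirical R X N) = 0%E.
    by rewrite probability_setC// alphaE subee.
  rewrite [RHS](@negligible_integral _ _ _ alpha setT (~` @empirical R X N))//.
    by rewrite setTD setCK.
  exact: measurableC.
apply: ge_ereal_sup => _ [A mA <-].
have [iF FE] := nu'E A mA; have [iT TE] := nuE A mA.
rewrite -[mu A]/(of_prob mu A) munu'// FE TE -integralB//.
set b := (X in (_ <= X)%E).
apply: (le_trans (le_abse_integral _ _ _)) => //.
  by apply: emeasurable_funB; [case/integrableP: iF|case/integrableP: iT].
(* The pointwise bound [b] is integrated against total mass 1. *)
rewrite -[leRHS]mule1 -(@probability_setT _ _ _ alpha).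
apply: integral_le_bound => //.
- by apply: emeasurable_funB; [case/integrableP: iF|case/integrableP: iT].
(* That [b] is nonnegative is read off from the remainder bound at an arbitrary measure. *)
- apply: le_trans (F_trunc_remainder (point : Pr X R) hk hN pltk mA); exact: abse_ge0.
- by apply: aeW => l _; exact: F_trunc_remainder.
Qed.
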